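(* For any (finite, simple, undirected) graph $G=(V,E)$ on $n$ vertices, $\dim(\mathfrak{g}_G)\le|\mathcal{P}_n/\mathrm{Aut}(G)|-1$, where $\mathfrak{g}_G$ is the dynamical Lie algebra of QAOA-MaxCut on $G$ and $|\mathcal{P}_n/\mathrm{Aut}(G)|$ is the number of orbits of the $n$-qubit Pauli strings under the action of the automorphism group of $G$.
   Context: Identify $V=\{1,\dots,n\}$. $X_j,Y_j,Z_j$ are Pauli matrices on qubit $j$. $\mathfrak{g}_G\subseteq\mathfrak{su}(2^n)$ is the real Lie algebra (bracket $[A,B]=AB-BA$) generated by $i\sum_{j\in V}X_j$ and $i\sum_{(j,k)\in E}Z_jZ_k$. $\mathcal{P}_n$ is the set of all Pauli strings $P_1\otimes\cdots\otimes P_n$, $P_j\in\{I,X,Y,Z\}$. $\mathrm{Aut}(G)=\{\pi\in S_n:(u,v)\in E\Leftrightarrow(\pi(u),\pi(v))\in E\}$ acts on Pauli strings by $\pi(P_1\otimes\cdots\otimes P_n)=P_{\pi(1)}\otimes\cdots\otimes P_{\pi(n)}$. *)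

(* Defs.v *)
From HB Require Import structures.
From mathcomp Require Import all_boot all_order all_algebra all_fingroup.
From mathcomp Require Import boolp reals.
From mathcomp Require Import complex mxtens.

Set Implicit Arguments.
Unset Strict Implicit.
Unset Printing Implicit Defensive.

Import Order.TTheory GRing.Theory Num.Theory.
Local Open Scope ring_scope.
Local Open Scope complex_scope.

(** 'M[R[i]]_N regarded as a vector space over R: it is an alias because
    'M[R[i]]_N itself carries the R[i]-module structure. On this type,
    \dim is the dimension over R. *)
Definition realified_mx (R : realType) (N : nat) : Type := 'M[R[i]]_N.

Section Realified.
Variables (R : realType) (N : nat).
Local Notation V := (realified_mx R N).

HB.instance Definition _ := GRing.Zmodule.copy V 'M[R[i]]_N.

Definition real_scale (a : R) (A : V) : V := (a%:C *: (A : 'M[R[i]]_N)).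

Fact real_scaleA a b A : real_scale a (real_scale b A) = real_scale (a * b) A.
Proof. by rewrite /real_scale scalerA rmorphM. Qed.
Fact real_scale1 : left_id 1 real_scale.
Proof. by move=> A; rewrite /real_scale rmorph1 scale1r. Qed.
Fact real_scaleDr : right_distributive real_scale +%R.
Proof. by move=> a A B; rewrite /real_scale scalerDr. Qed.
Fact real_scaleDl A : {morph real_scale^~ A : a b / a + b}.
Proof. by move=> a b; rewrite /real_scale rmorphD scalerDl. Qed.

HB.instance Definition _ := GRing.Zmodule_isLmodule.Build R V
  real_scaleA real_scale1 real_scaleDr real_scaleDl.

Definition re_im_row (A : V) : 'rV[R]_(N * N + N * N) :=
  row_mx (mxvec (map_mx (@complex.Re R) (A : 'M[R[i]]_N)))
         (mxvec (map_mx (@complex.Im R) (A : 'M[R[i]]_N))).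

Definition row_re_im (v : 'rV[R]_(N * N + N * N)) : V :=
  \matrix_(i, j) (vec_mx (lsubmx v) i j +i* vec_mx (rsubmx v) i j).

Fact re_im_rowK : cancel re_im_row row_re_im.
Proof.
move=> A; apply/matrixP=> i j; rewrite /row_re_im /re_im_row mxE.
by rewrite row_mxKl row_mxKr !mxvecK !mxE; case: (A i j).
Qed.

Fact row_re_imK : cancel row_re_im re_im_row.
Proof.
move=> v; rewrite /re_im_row -[RHS]hsubmxK; congr row_mx;
  rewrite -[RHS]vec_mxK; congr mxvec; apply/matrixP=> i j;
  by rewrite !mxE.
Qed.

Fact re_im_row_linear : linear re_im_row.
Proof.
move=> a A B; rewrite /re_im_row scale_row_mx add_row_mx -!linearZ -!linearD.
congr row_mx; congr mxvec; apply/matrixP=> i j; rewrite !mxE;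
  case: (A i j) (B i j) => [x y] [z t] /=; rewrite ?mul0r ?subr0 ?addr0 //.
Qed.

Fact realified_mx_vect : Vector.axiom (N * N + N * N) V.
Proof.
exists re_im_row; first exact: re_im_row_linear.
by exists row_re_im; [exact: re_im_rowK | exact: row_re_imK].
Qed.

HB.instance Definition _ := Lmodule_hasFinDim.Build R V realified_mx_vect.

Definition bracket (A B : V) : V :=
  ((A : 'M[R[i]]_N) *m (B : 'M[R[i]]_N) - (B : 'M[R[i]]_N) *m (A : 'M[R[i]]_N)).

Definition lie_subalgebra (g : {vspace V}) : Prop :=
  forall A B, A \in g -> B \in g -> bracket A B \in g.

Definition is_lie_generated (S : seq V) (g : {vspace V}) : Prop :=
  [/\ {subset S <= g}, lie_subalgebra g &
      forall h : {vspace V},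
        {subset S <= h} -> lie_subalgebra h -> (g <= h)%VS].

Fact lie_generated_subproof (S : seq V) : {g | is_lie_generated S g}.
Proof.
apply: cid.
pose P (n : nat) := `[< exists h : {vspace V},
  [/\ {subset S <= h}, lie_subalgebra h & \dim h = n] >].
have exP : exists n, P n.
  exists (\dim (fullv : {vspace V})); apply/asboolP; exists fullv.
  by split=> // [A _|A B _ _]; rewrite memvf.
case: (ex_minnP exP) => n /asboolP[g [Sg lg gn]] nmin.
exists g; split=> // h Sh lh.
suff /eqP <- : (g :&: h)%VS == g by exact: capvSr.
rewrite eqEdim capvSl gn /=; apply: nmin; apply/asboolP; exists (g :&: h)%VS.
split=> // [A AS|A B]; first by rewrite memv_cap Sg // Sh.
rewrite !memv_cap => /andP[Ag Ah] /andP[Bg Bh].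
by rewrite lg // lh.
Qed.

Definition lie_generated (S : seq V) : {vspace V} :=
  sval (lie_generated_subproof S).

Lemma lie_generatedP (S : seq V) : is_lie_generated S (lie_generated S).
Proof. exact: svalP. Qed.

End Realified.

Variant pauli : Set := PI | PX | PY | PZ.

Definition pauli_bits (P : pauli) : bool * bool :=
  match P with
  | PI => (false, false) | PX => (true, false)
  | PY => (true, true) | PZ => (false, true)
  end.

Definition bits_pauli (b : bool * bool) : pauli :=
  match b with
  | (false, false) => PI | (true, false) => PX
  | (true, true) => PY | (false, true) => PZ
  end.

Fact pauli_bitsK : cancel pauli_bits bits_pauli.
Proof. by case. Qed.

HB.instance Definition _ := Finite.copy pauli (can_type pauli_bitsK).

Definition pauli_mx (R : realType) (P : pauli) : 'M[R[i]]_2 :=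
  match P with
  | PI => 1%:M
  | PX => \matrix_(a, b) (a != b)%:R
  | PY => \matrix_(a, b) (if a == b then 0 else if a == 0 then - 'i%C else 'i%C)
  | PZ => \matrix_(a, b) (if a != b then 0 else if a == 0 then 1 else - 1)
  end.

(** Qubits are indexed by 'I_n, and s stands for s 0 (x) ... (x) s (n - 1). *)
Definition pauli_string (n : nat) : finType := {ffun 'I_n -> pauli}.

Fixpoint string_mx (R : realType) (n : nat) :
    pauli_string n -> 'M[R[i]]_(2 ^ n) :=
  match n with
  | 0 => fun=> 1%:M
  | m.+1 => fun s =>
      castmx (esym (expnS 2 m), esym (expnS 2 m))
        (pauli_mx R (s ord0) *t
         string_mx R ([ffun j => s (lift ord0 j)] : pauli_string m))
  end.

Definition on_qubit (R : realType) (n : nat) (P : pauli) (j : 'I_n) :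
    'M[R[i]]_(2 ^ n) :=
  string_mx R ([ffun k => if k == j then P else PI] : pauli_string n).

Definition mixer (R : realType) (n : nat) : realified_mx R (2 ^ n) :=
  'i%C *: (\sum_(j < n) on_qubit R PX j : 'M[R[i]]_(2 ^ n)).

(** Each undirected edge is counted once, as the pair j < k. *)
Definition cost (R : realType) (n : nat) (e : rel 'I_n) :
    realified_mx R (2 ^ n) :=
  'i%C *: (\sum_(j < n) \sum_(k < n | (j < k)%N && e j k)
           on_qubit R PZ j *m on_qubit R PZ k : 'M[R[i]]_(2 ^ n)).

Definition dla (R : realType) (n : nat) (e : rel 'I_n) :
    {vspace (realified_mx R (2 ^ n))} :=
  lie_generated [:: mixer R n; cost R e].

Definition graph_aut (n : nat) (e : rel 'I_n) : {set 'S_n} :=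
  [set p : 'S_n | [forall u, forall v, e u v == e (p u) (p v)]].

Definition permute_string (n : nat) (p : 'S_n) (s : pauli_string n) :
    pauli_string n := [ffun j => s (p j)].

(** This is not a mathcomp (right) action for the product of 'S_n, in which
    (p * q) j = q (p j), so orbits are taken directly as images. *)
Definition string_orbit (n : nat) (e : rel 'I_n) (s : pauli_string n) :
    {set pauli_string n} := [set permute_string p s | p in graph_aut e].

Definition string_orbits (n : nat) (e : rel 'I_n) :
    {set {set pauli_string n}} := [set string_orbit e s | s : pauli_string n].

(* Main.v *)
Require Import Defs.
From mathcomp Require Import all_boot all_order all_algebra all_fingroup.
From mathcomp Require Import reals.
From mathcomp Require Import complex mxtens ring.

Set Implicit Arguments.
Unset Strict Implicit.
Unset Printing Implicit Defensive.

Import Order.TTheory GRing.Theory Num.Theory.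
Local Open Scope ring_scope.
Local Open Scope complex_scope.

(** A product of two Pauli strings is a phase in {1, -1, i, -i} times a Pauli
    string, and exchanging the factors conjugates the phase. Hence the bracket
    of i * sum_s c(s) s and i * sum_t d(t) t, with c and d real, is
    i * sum_u f(u) u with f real; f(I...I) = 0 because u = I...I forces s = t,
    and f is Aut(G)-invariant if c and d are. The matrices i * sum_s c(s) s with
    c real, Aut(G)-invariant and zero at I...I thus form a Lie algebra, which
    contains both generators and is spanned by i times the orbit sums over the
    orbits other than {I...I}. *)

(** * Products of Pauli matrices and strings up to phase *)

(** Modulo phases the Pauli matrices form the group (Z/2)^2, the two bits marking a factor X and a
    factor Z, so multiplication is bitwise xor. *)
Definition pauli_mul (P Q : pauli) : pauli :=
  bits_pauli ((pauli_bits P).1 (+) (pauli_bits Q).1,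
              (pauli_bits P).2 (+) (pauli_bits Q).2).

Definition pauli_phase (R : realType) (P Q : pauli) : R[i] :=
  match P, Q with
  | PX, PY | PY, PZ | PZ, PX => 'i
  | PY, PX | PZ, PY | PX, PZ => - 'i
  | _, _ => 1
  end.

Lemma pauli_mx_mul (R : realType) (P Q : pauli) :
  pauli_mx R P *m pauli_mx R Q =
  pauli_phase R P Q *: pauli_mx R (pauli_mul P Q).
Proof.
have ii : ('i : R[i]) * 'i = -1 by rewrite -expr2 sqr_i.
by case: P; case: Q; rewrite ?mul1mx ?mulmx1 ?scale1r //;
  apply/matrixP=> a b; rewrite !mxE !big_ord_recl big_ord0 !mxE;
  case: a => [[|[|]] //= ?]; case: b => [[|[|]] //= ?];
  rewrite ?(mulr0, mul0r, mulr1, mul1r, mulrN, mulNr, addr0, add0r, ii,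
    opprK, oppr0).
Qed.

Lemma pauli_mulC : commutative pauli_mul. Proof. by case; case. Qed.
Lemma pauli_mulK P : involutive (pauli_mul P). Proof. by case: P; case. Qed.
Lemma pauli_mulPI P : pauli_mul P PI = P. Proof. by case: P. Qed.

(** Pauli matrices are Hermitian, so QP is the adjoint of PQ. *)
Lemma pauli_phase_conj (R : realType) (P Q : pauli) :
  pauli_phase R Q P = (pauli_phase R P Q)^*.
Proof.
by case: P; case: Q; apply/eqP; rewrite eq_complex /= ?oppr0 ?opprK !eqxx.
Qed.

Section Strings.
Variables (R : realType) (n : nat).
Implicit Types (s t u : pauli_string n) (p q : 'S_n).

Definition string_mul s t : pauli_string n := [ffun j => pauli_mul (s j) (t j)].
Definition string_id : pauli_string n := [ffun=> PI].
Definition string_phase s t : R[i] := \prod_(j < n) pauli_phase R (s j) (t j).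

Lemma string_mulC : commutative string_mul.
Proof. by move=> s t; apply/ffunP=> j; rewrite !ffunE pauli_mulC. Qed.

Lemma string_mulK s : involutive (string_mul s).
Proof. by move=> t; apply/ffunP=> j; rewrite !ffunE pauli_mulK. Qed.

Lemma string_mul1 s : string_mul s string_id = s.
Proof. by apply/ffunP=> j; rewrite !ffunE pauli_mulPI. Qed.

Lemma string_phase_conj s t : string_phase t s = (string_phase s t)^*.
Proof.
by rewrite rmorph_prod; apply: eq_bigr => j _; rewrite pauli_phase_conj.
Qed.

Lemma string_phasess s : string_phase s s = 1.
Proof. by apply: big1 => j _; case: (s j). Qed.

Lemma permute_stringM p q s :
  permute_string p (permute_string q s) = permute_string (p * q)%g s.
Proof. by apply/ffunP=> j; rewrite !ffunE permM. Qed.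

Lemma permute_string1 s : permute_string 1 s = s.
Proof. by apply/ffunP=> j; rewrite ffunE perm1. Qed.

Lemma permute_stringK p : cancel (permute_string p) (@permute_string n p^-1).
Proof. by move=> s; rewrite permute_stringM mulVg permute_string1. Qed.

Lemma permute_string_inj p : injective (@permute_string n p).
Proof. exact: can_inj (permute_stringK p). Qed.

Lemma permute_string_mul p s t :
  permute_string p (string_mul s t) =
  string_mul (permute_string p s) (permute_string p t).
Proof. by apply/ffunP=> j; rewrite !ffunE. Qed.

Lemma string_phase_permute p s t :
  string_phase (permute_string p s) (permute_string p t) = string_phase s t.
Proof.
rewrite /string_phase [RHS](reindex_inj (@perm_inj _ p)) /=.
by apply: eq_bigr => j _; rewrite !ffunE.
Qed.

End Strings.

(** * Products of Pauli string matrices *)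

Lemma castmx_mul (S : pzRingType) m m' (eq_m : m = m') (A B : 'M[S]_m) :
  castmx (eq_m, eq_m) A *m castmx (eq_m, eq_m) B = castmx (eq_m, eq_m) (A *m B).
Proof. by case: m' / eq_m; rewrite !castmx_id. Qed.

Lemma castmxZ (S : pzRingType) m m' (eq_m : m = m') a (A : 'M[S]_m) :
  castmx (eq_m, eq_m) (a *: A) = a *: castmx (eq_m, eq_m) A.
Proof. by case: m' / eq_m; rewrite !castmx_id. Qed.

Lemma tensmxZ (S : comPzRingType) m n p q a b
    (A : 'M[S]_(m, n)) (B : 'M[S]_(p, q)) :
  (a *: A) *t (b *: B) = (a * b) *: (A *t B).
Proof. by apply/matrixP=> i j; rewrite !mxE mulrACA. Qed.

(** Induction on the number of qubits: tensor products multiply factor by factor, and the scalar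
    phases are pulled out. *)
Lemma string_mx_mul (R : realType) (n : nat) (s t : pauli_string n) :
  string_mx R s *m string_mx R t =
  string_phase R s t *: string_mx R (string_mul s t).
Proof.
elim: n s t => [|n IHn] s t /=.
  by rewrite /string_phase big_ord0 scale1r mul1mx.
rewrite castmx_mul tensmx_mul pauli_mx_mul IHn tensmxZ castmxZ.
rewrite /string_phase big_ord_recl ffunE.
have -> : [ffun j => string_mul s t (lift ord0 j)] =
    string_mul [ffun j => s (lift ord0 j)] [ffun j => t (lift ord0 j)].
  by apply/ffunP=> j; rewrite !ffunE.
by congr (_ * _ *: _); apply: eq_bigr => j _; rewrite !ffunE.
Qed.

(** * Brackets of real combinations of Pauli strings *)

Section PauliSums.
Variables (R : realType) (n : nat).
Local Notation V := (realified_mx R (2 ^ n)).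
Implicit Types (s t u : pauli_string n) (c d : pauli_string n -> R).

Definition pauli_sum c : V :=
  'i *: (\sum_s (c s)%:C *: string_mx R s : 'M[R[i]]_(2 ^ n)).

(* With z the phase of s t, [i s, i t] = - (z - z^* ) u = i (- 2 Im z) u, where
   u = string_mul s t, that is t = string_mul s u. *)
Definition bracket_coef c d u : R :=
  \sum_s - (c s * d (string_mul s u) *
            complex.Im (string_phase R s (string_mul s u)) *+ 2).

Lemma eq_pauli_sum c d : c =1 d -> pauli_sum c = pauli_sum d.
Proof. by move=> cd; rewrite /pauli_sum; under eq_bigr do rewrite cd. Qed.

Lemma pauli_sum_linear (I : finType) (a : I -> R) (F : I -> pauli_string n -> R) :
  \sum_i a i *: pauli_sum (F i) = pauli_sum (fun s => \sum_i a i * F i s).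
Proof.
rewrite /pauli_sum.
under [in RHS]eq_bigr => s _ do rewrite rmorph_sum scaler_suml.
rewrite exchange_big scaler_sumr; apply: eq_bigr => i _.
(* Real scaling is unfolded to scaling by a complex number, so that it commutes with the factor
   ['i]. *)
rewrite -[LHS]/((a i)%:C *: ('i *: _ : 'M[R[i]]_(2 ^ n))) scalerA mulrC -scalerA.
rewrite scaler_sumr; apply: (congr1 ( *:%R 'i)); apply: eq_bigr => s _.
by rewrite scalerA -rmorphM.
Qed.

Lemma bracket_pauli_sum c d :
  bracket (pauli_sum c) (pauli_sum d) = pauli_sum (bracket_coef c d).
Proof.
have mulE a b : (pauli_sum a : 'M_(2 ^ n)) *m (pauli_sum b : 'M_(2 ^ n)) =
    - \sum_s \sum_t
      ((a s * b t)%:C * string_phase R s t) *: string_mx R (string_mul s t).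
  rewrite /pauli_sum -scalemxAl -scalemxAr scalerA -expr2 sqr_i scaleN1r.
  congr (- _); rewrite mulmx_suml; apply: eq_bigr => s _.
  rewrite mulmx_sumr; apply: eq_bigr => t _.
  by rewrite -scalemxAl -scalemxAr string_mx_mul !scalerA rmorphM.
(* Exchanging the sums in the second product pairs the term of [s t] with that of [t s]. *)
rewrite /bracket !mulE [X in _ - - X]exchange_big /= opprK addrC -sumrB.
rewrite /pauli_sum /bracket_coef.
under [in RHS]eq_bigr => u _ do rewrite rmorph_sum scaler_suml.
rewrite [in RHS]exchange_big scaler_sumr; apply: eq_bigr => s _.
rewrite scaler_sumr -sumrB.
(* For fixed [s], the resulting string and the second factor determine each other, so the sum over
   [u] becomes one over [t]. *)
rewrite [RHS](reindex_inj (can_inj (string_mulK s))) /=; apply: eq_bigr => t _.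
rewrite string_mulK (string_mulC t s) -scalerBl scalerA.
apply: (congr1 (fun z : R[i] => z *: string_mx R (string_mul s t))).
rewrite (string_phase_conj _ s t); case: (string_phase R s t) => x y.
apply/eqP; rewrite eq_complex /=; apply/andP; split; apply/eqP; ring.
Qed.

End PauliSums.

(** * Invariant coefficients and the span of the orbit sums *)

Section Orbits.
Variables (R : realType) (n : nat) (e : rel 'I_n).
Local Notation V := (realified_mx R (2 ^ n)).
Implicit Types (s t u : pauli_string n) (c d : pauli_string n -> R) (p q : 'S_n).
Local Notation id_orbit := (string_orbit e (string_id n)).

Lemma graph_autP p :
  reflect (forall i j, e i j = e (p i) (p j)) (p \in graph_aut e).
Proof.
rewrite inE; apply: (iffP forallP) => H u.
  by move=> v; apply/eqP; have /forallP := H u.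
by apply/forallP=> v; apply/eqP.
Qed.

Lemma graph_aut1 : 1%g \in graph_aut e.
Proof. by apply/graph_autP=> u v; rewrite !perm1. Qed.

Lemma graph_autM p q :
  p \in graph_aut e -> q \in graph_aut e -> (p * q)%g \in graph_aut e.
Proof.
move=> /graph_autP Hp /graph_autP Hq; apply/graph_autP=> u v.
by rewrite !permM -Hq.
Qed.

Lemma graph_autV p : p \in graph_aut e -> p^-1%g \in graph_aut e.
Proof. by move=> /graph_autP Hp; apply/graph_autP=> u v; rewrite [RHS]Hp !permKV. Qed.

(** Right translation by [p] permutes the automorphisms, so both images run over the same
    strings. *)
Lemma string_orbit_permute p s :
  p \in graph_aut e -> string_orbit e (permute_string p s) = string_orbit e s.
Proof.
move=> ep; apply/setP=> t; apply/imsetP/imsetP=> -[q eq ->].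
  by exists (q * p)%g; [exact: graph_autM | rewrite permute_stringM].
exists (q * p^-1)%g; first by apply: graph_autM => //; exact: graph_autV.
by rewrite permute_stringM mulgKV.
Qed.

Lemma mem_string_orbit s : s \in string_orbit e s.
Proof. by apply/imsetP; exists 1%g; [exact: graph_aut1 | rewrite permute_string1]. Qed.

(** Vanishing at the identity string discards its orbit, which yields the [- 1] of the bound. *)
Definition symmetric_coef c : Prop :=
  c (string_id n) = 0 /\
  forall p, p \in graph_aut e -> forall s, c (permute_string p s) = c s.

Lemma symmetric_coef_orbit c s t :
  symmetric_coef c -> string_orbit e s = string_orbit e t -> c s = c t.
Proof.
move=> [_ cP] st.
have /imsetP[p ep ->] : s \in string_orbit e t by rewrite -st mem_string_orbit.
exact: cP.
Qed.

Definition orbit_coef (B : {set pauli_string n}) s : R := (string_orbit e s == B)%:R.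

Definition orbit_sums : seq V :=
  [seq pauli_sum (orbit_coef B) | B <- enum (string_orbits e :\ id_orbit)].

Lemma size_orbit_sums : size orbit_sums = (#|string_orbits e| - 1)%N.
Proof.
by rewrite size_map -cardE [in RHS](cardsD1 id_orbit) imset_f // addKn.
Qed.

Lemma orbit_coef_symmetric B : B != id_orbit -> symmetric_coef (orbit_coef B).
Proof.
move=> nB; split; first by rewrite /orbit_coef eq_sym (negbTE nB).
by move=> p ep s; rewrite /orbit_coef string_orbit_permute.
Qed.

Lemma symmetric_coef_sum (I : finType) (a : I -> R) (F : I -> pauli_string n -> R) :
  (forall i, symmetric_coef (F i)) -> symmetric_coef (fun s => \sum_i a i * F i s).
Proof.
move=> HF; split; first by apply: big1 => i _; rewrite (HF i).1 mulr0.
by move=> p ep s; apply: eq_bigr => i _; rewrite (HF i).2.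
Qed.

(** An invariant function is constant on orbits, hence a combination of orbit indicators. *)
Lemma span_orbit_sumsP (A : V) :
  reflect (exists2 c, symmetric_coef c & A = pauli_sum c)
    (A \in <<orbit_sums>>%VS).
Proof.
apply: (iffP idP) => [|[c cP ->]].
  move/(@coord_span _ _ _ (in_tuple orbit_sums)) => AE.
  pose B i := nth set0 (enum (string_orbits e :\ id_orbit)) i.
  have szE : size orbit_sums = size (enum (string_orbits e :\ id_orbit)).
    by rewrite size_map.
  pose F (i : 'I_(size orbit_sums)) := orbit_coef (B i).
  exists (fun s => \sum_i coord (in_tuple orbit_sums) i A * F i s).
    apply: symmetric_coef_sum => i; apply: orbit_coef_symmetric.
    have := mem_nth set0 (n := i) (s := enum (string_orbits e :\ id_orbit)).
    by rewrite -szE ltn_ord mem_enum => /(_ isT) /setD1P[].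
  rewrite -pauli_sum_linear {1}AE; apply: eq_bigr => i _; congr (_ *: _).
  by rewrite (nth_map set0) // -szE.
(* The value of [c] at a chosen representative; the default 0 concerns only sets that are not
   orbits. *)
pose val B : R := if [pick s | string_orbit e s == B] is Some s then c s else 0.
have -> : pauli_sum c = \sum_(B : {set pauli_string n})
    (if B \in string_orbits e :\ id_orbit then val B else 0) *:
      pauli_sum (orbit_coef B).
  rewrite pauli_sum_linear; apply: eq_pauli_sum => s.
  rewrite (bigD1 (string_orbit e s)) //= [X in _ + X]big1 ?addr0 => [|B nB]; last first.
    by rewrite /orbit_coef eq_sym (negbTE nB) mulr0.
  rewrite /orbit_coef eqxx mulr1 !inE imset_f // andbT.
  (* The omitted identity orbit would contribute [c (string_id n)], which is 0. *)
  case: eqP => [sB|_] /=; first by rewrite (symmetric_coef_orbit cP sB) cP.1.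
  rewrite /val; case: pickP => [t /eqP ts|/(_ s)]; last by rewrite eqxx.
  exact: symmetric_coef_orbit.
apply: memv_suml => B _; case: ifP => Bid; last by rewrite scale0r mem0v.
by apply: memvZ; apply: memv_span; apply: map_f; rewrite mem_enum.
Qed.

(** At the identity string each phase is that of [s] with itself, which is real. Invariance follows
    by permuting the summation string, since permutations respect products and phases. *)
Lemma bracket_coef_symmetric c d :
  symmetric_coef c -> symmetric_coef d -> symmetric_coef (bracket_coef c d).
Proof.
move=> [_ cP] [_ dP]; split.
  by apply: big1 => s _; rewrite string_mul1 string_phasess /= mulr0 mul0rn oppr0.
move=> p ep u; rewrite /bracket_coef (reindex_inj (@permute_string_inj n p)) /=.
by apply: eq_bigr => s _; rewrite -permute_string_mul cP // dP // string_phase_permute.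
Qed.

Lemma lie_subalgebra_orbits : lie_subalgebra <<orbit_sums>>%VS.
Proof.
move=> A A' /span_orbit_sumsP[c cP ->] /span_orbit_sumsP[d dP ->].
rewrite bracket_pauli_sum; apply/span_orbit_sumsP.
by exists (bracket_coef c d) => //; exact: bracket_coef_symmetric.
Qed.

(** * The two generators lie in the span *)

Definition qubit_string (P : pauli) (j : 'I_n) : pauli_string n :=
  [ffun k => if k == j then P else PI].

Lemma permute_qubit_string p P j :
  permute_string p (qubit_string P (p j)) = qubit_string P j.
Proof. by apply/ffunP=> k; rewrite !ffunE (inj_eq perm_inj). Qed.

Lemma sum_indicator_string_mx t :
  \sum_s ((s == t)%:R : R)%:C *: string_mx R s = string_mx R t.
Proof.
rewrite (bigD1 t) //= eqxx scale1r big1 ?addr0 // => s /negbTE ->.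
by rewrite scale0r.
Qed.

Lemma mixer_orbits : mixer R n \in <<orbit_sums>>%VS.
Proof.
apply/span_orbit_sumsP; exists (fun s => \sum_j (s == qubit_string PX j)%:R).
  split=> [|p ep s].
    apply: big1 => j _; case: eqP => // /ffunP/(_ j).
    by rewrite !ffunE eqxx.
  rewrite [RHS](reindex_inj (@perm_inj _ p)) /=; apply: eq_bigr => j _.
  by rewrite -(permute_qubit_string p) (inj_eq (@permute_string_inj n p)).
apply: (congr1 ( *:%R 'i)); under [RHS]eq_bigr => s _ do rewrite rmorph_sum scaler_suml.
by rewrite exchange_big; apply: eq_bigr => j _; rewrite sum_indicator_string_mx.
Qed.

Definition edge_string j k : pauli_string n :=
  string_mul (qubit_string PZ j) (qubit_string PZ k).

(** On each qubit only I and Z meet, so every phase is 1. *)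
Lemma on_qubit_edge j k :
  on_qubit R PZ j *m on_qubit R PZ k = string_mx R (edge_string j k).
Proof.
rewrite /on_qubit string_mx_mul /string_phase big1 ?scale1r // => l _.
by rewrite !ffunE; do 2?case: eqP.
Qed.

Lemma edge_string_neq_id j k : j != k -> edge_string j k != string_id n.
Proof.
move=> jk; apply/eqP=> /ffunP/(_ j).
by rewrite !ffunE eqxx (negbTE jk).
Qed.

Definition edge_coef s : R :=
  \sum_(j < n) \sum_(k < n | (j < k)%N && e j k) (s == edge_string j k)%:R.

(* Summing over ordered pairs makes invariance visible: an automorphism need not
   preserve j < k. *)
Lemma edge_coef_double (e_sym : symmetric e) (e_irr : irreflexive e) s :
  edge_coef s *+ 2 = \sum_j \sum_(k | e j k) (s == edge_string j k)%:R.
Proof.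
have -> : edge_coef s *+ 2 = edge_coef s +
    \sum_(j < n) \sum_(k < n | (k < j)%N && e j k) (s == edge_string j k)%:R.
  rewrite mulr2n; congr (_ + _); rewrite /edge_coef (exchange_big_dep predT) //=.
  apply: eq_bigr => j _; apply: eq_big => k; first by rewrite e_sym.
  by move=> _; rewrite /edge_string string_mulC.
rewrite -big_split; apply: eq_bigr => j _ /=.
rewrite [RHS](bigID (fun k : 'I_n => (j < k)%N)) /=; congr (_ + _).
  by apply: eq_bigl => k; rewrite andbC.
(* Among neighbours of [j], failing [j < k] means [k < j], because a loop at [j] is excluded. *)
apply: eq_bigl => k; rewrite andbC; case ejk: (e j k) => //=.
rewrite -leqNgt ltn_neqAle; case: eqP => // /val_inj kj.
by rewrite kj e_irr in ejk.
Qed.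

Lemma cost_orbits : symmetric e -> irreflexive e -> cost R e \in <<orbit_sums>>%VS.
Proof.
move=> e_sym e_irr; apply/span_orbit_sumsP; exists edge_coef.
  split=> [|p ep s].
    apply: big1 => j _; apply: big1 => k /andP[jk _].
    rewrite eq_sym (negbTE (edge_string_neq_id _)) //.
    by rewrite -val_eqE neq_ltn jk.
  (* Doubling is injective on reals, so invariance may be checked on the sum over ordered pairs,
     where both endpoints can be reindexed by [p]. *)
  apply: (@pmulrnI _ 2) => //; rewrite !edge_coef_double //.
  rewrite [RHS](reindex_inj (@perm_inj _ p)) /=; apply: eq_bigr => j _.
  rewrite [RHS](reindex_inj (@perm_inj _ p)) /=.
  apply: eq_big => k; first exact: (graph_autP _ ep).
  move=> _; rewrite /edge_string -(permute_qubit_string p PZ j)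
    -(permute_qubit_string p PZ k) -permute_string_mul.
  by rewrite (inj_eq (@permute_string_inj n p)).
apply: (congr1 ( *:%R 'i)); under [RHS]eq_bigr => s _ do rewrite rmorph_sum scaler_suml.
rewrite exchange_big; apply: eq_bigr => j _.
under [RHS]eq_bigr => s _ do rewrite rmorph_sum scaler_suml.
rewrite exchange_big; apply: eq_bigr => k _.
by rewrite sum_indicator_string_mx on_qubit_edge.
Qed.

End Orbits.

Theorem theorem9 (R : realType) (n : nat) (e : rel 'I_n)
    (e_sym : symmetric e) (e_irr : irreflexive e) :
  (\dim (dla R e) <= #|string_orbits e| - 1)%N.
Proof.
have [_ _ dla_min] := lie_generatedP [:: mixer R n; cost R e].
(* A span has dimension at most the number of its generators; minimality places the generated
   algebra inside it. *)
rewrite -(size_orbit_sums R e); apply: leq_trans (dim_span _).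
apply/dimvS/dla_min; last exact: lie_subalgebra_orbits.
move=> A; rewrite !inE => /orP[] /eqP->; first exact: mixer_orbits.
exact: cost_orbits.
Qed.
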